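(* Let $r\ge 1$, let $\tau$ be a bijection from $F^r$ to $F^r$ with $\tau({\bf 0})={\bf 0}$, and let $k$ be the deficiency of $\tau$. Let $S_{\mathcal H,\tau}=\bigcup_{a\in F^r}\mathcal H_a\times\mathcal H_{\tau(a)}$. Then $$\dim(\mathrm{Ker}(S_{\mathcal H,\tau}))=2^{r+1}-r-2-k.$$
   Context: $F=\mathrm{GF}(2)$; a code of length $n$ is a set of vectors of $F^n$. $\mathrm{wt}$ is Hamming weight. ${\bf 0}$ denotes the all-zero vector. The kernel $\mathrm{Ker}(C)$ of a code $C$ of length $n$ is the set of all $x\in F^n$ with $x+C=C$ (a linear subspace). The coordinates of $F^{2^r}$ are indexed by the vectors of $F^r$; $e_a$ is the vector whose only nonzero coordinate is the one indexed by $a$. $\mathcal H=\{c\in F^{2^r}:\sum_{a:c_a=1}a={\bf 0},\ \mathrm{wt}(c)\equiv 0 \pmod 2\}$, and $\mathcal H_a=\mathcal H+e_a+e_{\bf 0}$ for $a\in F^r$. For codes $C,D$, $C\times D=\{x|y: x\in C,\ y\in D\}$, where $x|y$ is concatenation. For nonzero $a\in F^r$, $\mathrm{Star}(a)=\{\{a,b,a+b\}: b\in F^r\setminus\{{\bf 0},a\}\}$ (the supports of the weight-3 codewords, having a one in coordinate $a$, of the Hamming code $\mathcal H'=\{c\in F^{2^r-1}:\sum_{a:c_a=1}a={\bf 0}\}$, whose coordinates are indexed by nonzero vectors of $F^r$). For a bijection $\tau:F^r\to F^r$ fixing ${\bf 0}$, $\tau(\mathrm{Star}(a))=\{\{\tau(a),\tau(b),\tau(a+b)\}: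 b\in F^r\setminus\{{\bf 0},a\}\}$. The number of nonzero $a$ with $\tau(\mathrm{Star}(a))=\mathrm{Star}(\tau(a))$ is always a power of two minus one, and the deficiency of $\tau$ is $r-\log_2\left(|\{a\in F^r\setminus\{{\bf 0}\}:\tau(\mathrm{Star}(a))=\mathrm{Star}(\tau(a))\}|+1\right)$. *)

(* Defs.v *)
From HB Require Import structures.
From mathcomp Require Import all_boot all_order all_algebra finfield.

Set Implicit Arguments.
Unset Strict Implicit.
Unset Printing Implicit Defensive.

Import GRing.Theory.
Local Open Scope ring_scope.

Notation vec r := 'rV['F_2]_r.

(* Words whose coordinates are indexed by the finite type I; ^o makes this an
   'F_2-vector space, with coordinatewise operations. *)
Notation word I := {ffun I -> ('F_2)^o}.

Section Codes.
Variables I J : finType.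

Definition wt (c : word I) : nat := #|[set i | c i != 0]|.

Definition unit_word (i : I) : word I := [ffun j => (j == i)%:R].

Definition translate (x : word I) (C : {set word I}) : {set word I} :=
  [set x + c | c in C].

Definition kernel (C : {set word I}) : {set word I} :=
  [set x | translate x C == C].

Lemma translate0 (C : {set word I}) : translate 0 C = C.
Proof. by rewrite /translate -[RHS]imset_id; apply: eq_imset => c; rewrite add0r. Qed.

Lemma translateD x y (C : {set word I}) :
  translate (x + y) C = translate x (translate y C).
Proof.
by rewrite /translate -imset_comp; apply: eq_imset => c /=; rewrite addrA.
Qed.

Lemma kernel0 (C : {set word I}) : 0 \in kernel C.
Proof. by rewrite inE translate0. Qed.

Lemma kernelD (C : {set word I}) x y :
  x \in kernel C -> y \in kernel C -> x + y \in kernel C.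
Proof. by rewrite !inE translateD => /eqP Cx /eqP->; rewrite Cx. Qed.

Lemma F2E (a : 'F_2) : a = 0 \/ a = 1.
Proof.
case: a => [[|[|m]] //= ltm]; [left | right]; exact: val_inj.
Qed.

Lemma kernelZ (C : {set word I}) (a : 'F_2) x :
  x \in kernel C -> a *: x \in kernel C.
Proof.
by case: (F2E a) => -> Cx; rewrite ?scale0r ?scale1r ?kernel0.
Qed.

(* The kernel as a subspace; the span adds nothing, by mem_kernel_space. *)
Definition kernel_space (C : {set word I}) : {vspace word I} :=
  <<enum (kernel C)>>%VS.

Lemma mem_kernel_space C x : (x \in kernel_space C) = (x \in kernel C).
Proof.
apply/idP/idP => [/coord_span -> | Cx]; last first.
  by apply: memv_span; rewrite mem_enum.
apply: (big_ind (fun u => u \in kernel C)) => [|u v|i _].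
- exact: kernel0.
- exact: kernelD.
by apply: kernelZ; rewrite -(mem_enum (kernel C)) mem_nth -?cardE.
Qed.

Definition concat (x : word I) (y : word J) : word (I + J)%type :=
  [ffun k => match k with inl i => x i | inr j => y j end].

Definition code_prod (C : {set word I}) (D : {set word J}) :
    {set word (I + J)%type} :=
  [set concat x y | x in C, y in D].

End Codes.

Section Hamming.
Variable r : nat.
Implicit Types (a b : vec r) (tau : vec r -> vec r).

Definition ext_hamming : {set word (vec r)} :=
  [set c : word (vec r) | (\sum_(a | c a == 1) a == 0) && ~~ odd (wt c)].

Definition ext_hamming_coset a : {set word (vec r)} :=
  [set c + unit_word a + unit_word 0 | c : word (vec r) in ext_hamming].

Definition Star a : {set {set vec r}} :=
  [set [set a; b; a + b] | b in [set~ 0] :\ a].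

Definition imStar tau a : {set {set vec r}} :=
  [set [set tau a; tau b; tau (a + b)] | b in [set~ 0] :\ a].

Definition good_stars tau : {set vec r} :=
  [set a | (a != 0) && (imStar tau a == Star (tau a))].

(* r - log2(#|good_stars tau| + 1). For tau bijective with tau 0 = 0, the
   logarithm is exact and the subtraction is not truncated: see deficiencyE. *)
Definition deficiency tau : nat := (r - trunc_log 2 #|good_stars tau|.+1)%N.

Definition S_code tau : {set word (vec r + vec r)%type} :=
  \bigcup_(a : vec r) code_prod (ext_hamming_coset a) (ext_hamming_coset (tau a)).

Lemma addvv a : a + a = 0.
Proof.
apply/rowP => i; rewrite !mxE; case: (F2E (a 0 i)) => ->; first by rewrite addr0.
exact/val_inj.
Qed.

Lemma addvK a b : a + (a + b) = b.
Proof. by rewrite addrA addvv add0r. Qed.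

Lemma imStar_eqP tau a : bijective tau -> tau 0 = 0 -> a != 0 ->
  reflect (forall b, tau (a + b) = tau a + tau b) (imStar tau a == Star (tau a)).
Proof.
move=> bij_tau tau0 a_nz; have inj_tau := bij_inj bij_tau.
have tau_nz x : (tau x == 0) = (x == 0) by rewrite -{1}tau0 (inj_eq inj_tau).
apply: (iffP eqP) => [eqS b | lin_a].
  have [-> | b_nz] := eqVneq b 0; first by rewrite tau0 !addr0.
  have [-> | b_a] := eqVneq b a; first by rewrite !addvv.
  have: [set tau a; tau b; tau (a + b)] \in imStar tau a.
    by apply: imset_f; rewrite !inE b_a.
  rewrite eqS => /imsetP[c]; rewrite !inE => /andP[c_a c_nz] /setP eqT.
  have := eqT (tau b); have := eqT (tau (a + b)); rewrite !inE !eqxx !orbT.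
  rewrite !(inj_eq inj_tau) (negPf b_a) /=.
  have -> : (a + b == a) = false.
    by rewrite -subr_eq0 addrAC subrr add0r (negPf b_nz).
  move=> /esym /orP[]/eqP abE /esym /orP[]/eqP bE.
  - have /inj_tau/eqP : tau (a + b) = tau b by rewrite abE bE.
    by rewrite -subr_eq0 addrK (negPf a_nz).
  - by rewrite bE abE addvK.
  - by rewrite abE bE.
  - have /inj_tau/eqP : tau (a + b) = tau b by rewrite abE bE.
    by rewrite -subr_eq0 addrK (negPf a_nz).
have [g gK Kg] := bij_tau.
apply/setP=> T; apply/imsetP/imsetP => -[b]; rewrite !inE => /andP[b_a b_nz] ->.
  by exists (tau b); rewrite ?lin_a // !inE (inj_eq inj_tau) tau_nz b_a.
exists (g b); last by rewrite lin_a Kg.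
by rewrite !inE -(inj_eq inj_tau) Kg b_a -tau_nz Kg.
Qed.

Lemma deficiencyE tau : bijective tau -> tau 0 = 0 ->
  (deficiency tau <= r)%N /\ #|good_stars tau|.+1 = (2 ^ (r - deficiency tau))%N.
Proof.
move=> bij_tau tau0; split; first exact: leq_subr.
pose L := [set a | [forall b, tau (a + b) == tau a + tau b]].
have LP a : reflect (forall b, tau (a + b) = tau a + tau b) (a \in L).
  by rewrite inE; apply: (iffP forallP) => E b; apply/eqP.
have L0 : 0 \in L by apply/LP => b; rewrite tau0 !add0r.
have LD a b : a \in L -> b \in L -> a + b \in L.
  by move=> /LP La /LP Lb; apply/LP => c; rewrite -addrA !La Lb addrA.
have goodE : good_stars tau = L :\ 0.
  apply/setP=> a; rewrite in_setD1 [LHS]inE; case: eqVneq => //= a_nz.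
  exact: (sameP (imStar_eqP bij_tau tau0 a_nz) (LP a)).
have cardL : #|good_stars tau|.+1 = #|L| by rewrite goodE [RHS](cardsD1 0) L0.
pose W : {vspace vec r} := <<enum L>>%VS.
have memW a : (a \in W) = (a \in L).
  apply/idP/idP => [/coord_span -> | La]; last first.
    by apply: memv_span; rewrite mem_enum.
  apply: (big_ind (fun u => u \in L)) => [//|u v|i _]; first exact: LD.
  move: (coord _ _ _) => x; case: (F2E x) => ->; first by rewrite scale0r.
  by rewrite scale1r -(mem_enum L) mem_nth -?cardE.
have cardW : #|L| = (2 ^ \dim W)%N.
  have <- : #|W| = #|L| by apply: eq_card => a; rewrite memW.
  by rewrite card_vspace card_Fp.
rewrite cardL /deficiency cardL cardW trunc_expnK // subKn //.
by have := dimvS (subvf W); rewrite dimvf /dim /= mul1n.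
Qed.

End Hamming.

(* Main.v *)
(* The syndrome of a word c is the pair (sum of the c_a, sum of the c_a a), so
   that the coset H_a is the set of words of syndrome (0, a), and x|y is in S
   iff x and y have syndromes (0, a) and (0, tau a) for some a. Hence x|y is in
   the kernel iff moreover tau (a + b) = tau a + tau b for all b. These a are 0
   and the a whose star is preserved, 2 ^ (r - k) in all; as the pair of
   syndromes is a linear surjection from F^(2 * 2^r) onto F^(2 * (r + 1)), the
   kernel has dimension 2^(r+1) - 2 (r + 1) + r - k. *)
Require Import Defs.
From mathcomp Require Import all_boot all_order all_algebra.
From HB Require Import structures.
From mathcomp Require Import finfield zify.

Import GRing.Theory.
Local Open Scope ring_scope.

(* Products and finite powers of finite groups are finZmodTypes only after
   these joins are declared. *)
HB.instance Definition _ (A B : finZmodType) := Finite.on (A * B)%type.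
HB.instance Definition _ (I : finType) (A : finZmodType) :=
  Finite.on {ffun I -> A}.

(** Every fibre of [f] is a translate of the fibre [K] over 0, so [f @^-1: A] has [#|A| * #|K|]
    elements for every [A]; the case of all of [W] gives [#|U|], and eliminating [#|K|] leaves an
    identity free of division. *)
Lemma card_surj_preimset (U W : finZmodType) (f : {additive U -> W})
    (G : {set W}) (f_surj : forall w, exists u, f u = w) :
  (#|f @^-1: G| * #|W| = #|G| * #|U|)%N.
Proof.
pose K := f @^-1: [set 0].
have card_pre (A : {set W}) : #|f @^-1: A| = (#|A| * #|K|)%N.
  rewrite -sum1_card (partition_big f (mem A)) /=; last by move=> u; rewrite inE.
  rewrite -sum_nat_const; apply: eq_bigr => w Aw; have [v fv] := f_surj w.
  rewrite sum1_card -(card_imset K (addrI v)); apply: eq_card => u.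
  rewrite [LHS]inE /= inE; apply/andP/imsetP => [[_ /eqP fu] | [k]].
    by exists (u - v); [rewrite !inE raddfB fu fv subrr | rewrite addrC subrK].
  by rewrite !inE => /eqP fk ->; rewrite raddfD fk fv addr0 Aw eqxx.
have cardU : #|U| = (#|W| * #|K|)%N.
  by rewrite -!cardsT -card_pre preimsetT.
by rewrite card_pre cardU mulnCA mulnC mulnA.
Qed.

Lemma concatD (I J : finType) (x x' : word I) (y y' : word J) :
  concat x y + concat x' y' = concat (x + x') (y + y').
Proof. by apply/ffunP => -[i|j]; rewrite !ffunE. Qed.

Lemma concat_surj (I J : finType) (z : word (I + J)%type) :
  exists x y, z = concat x y.
Proof.
exists [ffun i => z (inl i)], [ffun j => z (inr j)].
by apply/ffunP => -[i|j]; rewrite !ffunE.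
Qed.

Lemma F2_natr_odd n : (n%:R : 'F_2) = (odd n)%:R.
Proof.
elim: n => //= n IHn; rewrite mulrSr IHn.
by case: (odd n); apply: val_inj.
Qed.

Section Syndrome.
Variable r : nat.
Implicit Types (a b : vec r) (x y c : word (vec r)).

Definition syndrome c : 'F_2 * vec r :=
  (\sum_a (c a : 'F_2), \sum_a (c a : 'F_2) *: a).

Lemma syndromeD : {morph syndrome : x y / x + y}.
Proof.
move=> x y; rewrite /syndrome; congr pair => /=; rewrite -big_split /=.
  by apply: eq_bigr => i _; rewrite ffunE.
by apply: eq_bigr => i _; rewrite ffunE scalerDl.
Qed.

Lemma syndrome_unit a : syndrome (unit_word a) = (1, a).
Proof.
rewrite /syndrome (bigD1 a) //= [in X in (_, X)](bigD1 a) //= ffunE eqxx.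
rewrite !big1 ?addr0 ?scale1r // => b /negPf ba; rewrite ffunE ba //.
by rewrite scale0r.
Qed.

(** The sum of the coordinates in ['F_2] is the weight mod 2, and the scalars [c a] select the [a]
    in the support, so the two conditions on a codeword are the two components of the syndrome. *)
Lemma mem_ext_hamming c : (c \in ext_hamming r) = (syndrome c == 0).
Proof.
rewrite inE andbC xpair_eqE; congr andb; last first.
  congr (_ == _); rewrite big_mkcond /=; apply: eq_bigr => a _.
  by case: (F2E (c a)) => ->; rewrite ?scale0r ?scale1r.
have -> : \sum_a (c a : 'F_2) = (wt c)%:R.
  rewrite /wt -sum1_card natr_sum [RHS]big_mkcond /=; apply: eq_bigr => a _.
  by rewrite inE; case: (F2E (c a)) => ->.
by rewrite F2_natr_odd; case: odd.
Qed.

Lemma mem_ext_hamming_coset a c :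
  (c \in ext_hamming_coset a) = (syndrome c == (0, a)).
Proof.
have syn_e : syndrome (unit_word a + unit_word 0) = (0, a).
  by rewrite syndromeD !syndrome_unit; congr pair; [apply: val_inj | apply: addr0].
apply/imsetP/eqP => [[d] | syn_c].
  by rewrite mem_ext_hamming -addrA => /eqP sd ->; rewrite syndromeD sd add0r.
(* In characteristic 2 the shift that defines the coset is its own inverse. *)
exists (c + (unit_word a + unit_word 0)).
  rewrite mem_ext_hamming syndromeD syn_c syn_e.
  by apply/eqP; congr pair; [apply: val_inj | apply: Defs.addvv].
apply/ffunP => b; rewrite !ffunE.
by case: (b == a); case: (b == 0); apply: val_inj; case: (F2E (c b)) => ->.
Qed.

(** The index of the union can only be the second component of the syndrome of [x], so no quantifier
    remains. *)
Lemma mem_S_code tau x y :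
  (concat x y \in S_code tau)
    = (syndrome x == (0, (syndrome x).2))
      && (syndrome y == (0, tau (syndrome x).2)).
Proof.
apply/bigcupP/andP => [[a _ /imset2P[x' y']] | [sx sy]].
  rewrite !mem_ext_hamming_coset => /eqP sx /eqP sy /ffunP E.
  have -> : x = x' by apply/ffunP => b; have := E (inl b); rewrite !ffunE.
  have -> : y = y' by apply/ffunP => b; have := E (inr b); rewrite !ffunE.
  by rewrite sx sy !eqxx.
by exists (syndrome x).2; rewrite // imset2_f // mem_ext_hamming_coset.
Qed.

Lemma syndrome_surj (w : 'F_2 * vec r) : exists c, syndrome c = w.
Proof.
case: w => p a; have [->|->] := F2E p; last first.
  by exists (unit_word a); rewrite syndrome_unit.
exists (unit_word a + unit_word 0); rewrite syndromeD !syndrome_unit.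
by congr pair; rewrite /= ?addr0 //; apply: val_inj.
Qed.

Definition syndrome2 (z : word (vec r + vec r)%type) :
    ('F_2 * vec r) * ('F_2 * vec r) :=
  (syndrome [ffun a => z (inl a)], syndrome [ffun a => z (inr a)]).

Lemma syndrome2_concat x y : syndrome2 (concat x y) = (syndrome x, syndrome y).
Proof.
by congr (syndrome _, syndrome _); apply/ffunP => a; rewrite !ffunE.
Qed.

Lemma syndrome2D : {morph syndrome2 : z z' / z + z'}.
Proof.
move=> z z'; have [x [y ->]] := concat_surj _ _ z.
have [x' [y' ->]] := concat_surj _ _ z'.
by rewrite concatD !syndrome2_concat !syndromeD.
Qed.

Lemma syndrome2_is_zmod_morphism : zmod_morphism syndrome2.
Proof.
move=> z z'; apply: (addIr (syndrome2 z')).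
by rewrite -syndrome2D !subrK.
Qed.

HB.instance Definition _ := GRing.isZmodMorphism.Build _ _ syndrome2
  syndrome2_is_zmod_morphism.

Lemma syndrome2_surj w : exists z, syndrome2 z = w.
Proof.
case: w => u v; have [x xu] := syndrome_surj u; have [y yv] := syndrome_surj v.
by exists (concat x y); rewrite syndrome2_concat xu yv.
Qed.

Definition additivity_set (tau : vec r -> vec r) : {set vec r} :=
  [set a | [forall b, tau (a + b) == tau a + tau b]].

Lemma additivity_setP tau a :
  reflect (forall b, tau (a + b) = tau a + tau b) (a \in additivity_set tau).
Proof. by rewrite inE; apply: (iffP forallP) => E b; apply/eqP. Qed.

(** The vector 0 lies in [additivity_set tau] but not in [good_stars tau], which accounts for the
    successor in [deficiencyE]. *)
Lemma card_additivity_set tau : bijective tau -> tau 0 = 0 ->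
  #|additivity_set tau| = (2 ^ (r - deficiency tau))%N.
Proof.
move=> bij_tau tau0; have [_ <-] := deficiencyE bij_tau tau0.
have -> : good_stars tau = additivity_set tau :\ 0.
  apply/setP=> a; rewrite in_setD1 [LHS]inE; case: eqVneq => //= a_nz.
  exact: (sameP (imStar_eqP bij_tau tau0 a_nz) (additivity_setP tau a)).
rewrite [LHS](cardsD1 0); suff -> : 0 \in additivity_set tau by [].
by apply/additivity_setP => b; rewrite tau0 !add0r.
Qed.

(* As 0 is a codeword, kernel words are codewords; adding a kernel word of
   syndromes (0, a) and (0, tau a) to codewords of all possible syndromes forces
   tau (a + b) = tau a + tau b for all b. *)
Lemma kernel_S_codeE tau : tau 0 = 0 ->
  kernel (S_code tau)
    = syndrome2 @^-1: [set ((0, a), (0, tau a)) | a in additivity_set tau].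
Proof.
move=> tau0; apply/setP => z; have [x [y ->]] := concat_surj _ _ z.
rewrite !inE syndrome2_concat; apply/eqP/imsetP => [kerz | [a /additivity_setP La]].
  have Sz u v : concat u v \in S_code tau -> concat (x + u) (y + v) \in S_code tau.
    by move=> Suv; rewrite -concatD -kerz imset_f.
  have syn0 : syndrome 0 = 0 by apply: (addIr (syndrome 0)); rewrite -syndromeD !add0r.
  have: concat x y \in S_code tau.
    rewrite -[x]addr0 -[y]addr0; apply: Sz.
    by rewrite mem_S_code syn0 /= tau0 eqxx.
  rewrite mem_S_code => /andP[/eqP sx /eqP sy].
  exists (syndrome x).2; last by rewrite -sx sy.
  apply/additivity_setP => b.
  have [u su] := syndrome_surj (0, b); have [v sv] := syndrome_surj (0, tau b).
  have /Sz : concat u v \in S_code tau by rewrite mem_S_code su sv !eqxx.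
  rewrite mem_S_code !syndromeD su sv sy => /andP[_].
  by rewrite xpair_eqE => /andP[_ /eqP/= <-].
move=> E; have /= sx := congr1 fst E; have /= sy := congr1 snd E; apply/eqP.
have add0p a' b : (0, a') + (0, b) = (0, a' + b) :> 'F_2 * vec r.
  by congr pair; apply: addr0.
(* Translation is injective, so the translate has the size of [S_code tau] and one inclusion already
   gives equality. *)
rewrite eqEcard card_imset ?leqnn ?andbT; last exact: addrI.
apply/subsetP => _ /imsetP[w + ->]; have [u [v ->]] := concat_surj _ _ w.
rewrite concatD !mem_S_code !syndromeD sx sy => /andP[/eqP-> /eqP->] /=.
by rewrite La !add0p !eqxx.
Qed.

End Syndrome.

Theorem lemma2 (r : nat) (tau : 'rV['F_2]_r -> 'rV['F_2]_r)
    (hr : (1 <= r)%N) (tau_bij : bijective tau) (tau0 : tau 0 = 0) :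
  (\dim (kernel_space (S_code tau)))%:Z
    = 2%:Z ^+ r.+1 - r%:Z - 2%:Z - (deficiency tau)%:Z.
Proof.
have [le_def _] := deficiencyE tau_bij tau0.
have cardK : #|kernel (S_code tau)| = (2 ^ \dim (kernel_space (S_code tau)))%N.
  rewrite -(eq_card (mem_kernel_space (S_code tau))).
  by rewrite card_vspace card_Fp.
have cardV : #|{: vec r}| = (2 ^ r)%N by rewrite card_mx card_Fp // mul1n.
have := card_surj_preimset _ _ (@syndrome2 r)
  [set ((0, a), (0, tau a)) | a in additivity_set r tau] (syndrome2_surj r).
(* With d the dimension and k the deficiency, the count becomes 2^d * 2^(2(r+1)) = 2^(r-k) * 2^(2^r
   + 2^r), and the exponents are compared. *)
rewrite -kernel_S_codeE // cardK card_imset; last by move=> a b [].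
rewrite card_additivity_set // !card_prod card_ffun card_sum cardV !card_Fp //.
rewrite -!(expnS, expnD) => /eqP.
rewrite eqn_exp2l // => /eqP dimE.
have -> : 2%:Z ^+ r.+1 = (2 * 2 ^ r)%N%:Z by rewrite -expnS -[RHS]natz natrX natz.
(* By [le_def] the natural subtraction [r - deficiency tau] is not truncated. *)
lia.
Qed.
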